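(* Let $k\in\mathbb{N}$ and let $X$ be a complex normed linear space of dimension at least $k+1$, with unit sphere $S_X$ and closed unit ball $B_X$. An element $x\in S_X$ is a $k$-extreme point of $B_X$ if and only if for all $u_1,\dots,u_k\in X$, the conditions $x+u_i\in B_X$ for $i=1,\dots,k$ and $x-\sum_{i=1}^k u_i\in B_X$ imply that $u_1,u_2,\dots,u_k$ are linearly dependent.
   Context: A point $x\in S_X$ is a $k$-extreme point of $B_X$ if whenever $x=\frac1{k+1}\sum_{i=1}^{k+1}x_i$ with all $x_i\in S_X$, the elements $x_1,\dots,x_{k+1}$ are linearly dependent (over $\mathbb{C}$). *)

(* Defs.v *)
From HB Require Import structures.
From mathcomp Require Import all_boot all_order all_algebra.
From mathcomp Require Export complex.
From mathcomp Require Import all_classical reals topology normedtype.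

Set Implicit Arguments.
Unset Strict Implicit.
Unset Printing Implicit Defensive.
Import Order.TTheory GRing.Theory Num.Theory.
Import numFieldNormedType.Exports.
Local Open Scope classical_set_scope.
Local Open Scope ring_scope.
Local Open Scope complex_scope.

(* Linear dependence of a finite indexed family (so repetitions count); the
   library's [free] only covers vector spaces of finite dimension. *)
Definition lin_dep (K : fieldType) (V : lmodType K) (n : nat)
    (v : 'I_n -> V) : Prop :=
  exists c : 'I_n -> K,
    (exists i, c i != 0) /\ \sum_(i < n) c i *: v i = 0.

Definition dim_at_least (K : fieldType) (V : lmodType K) (n : nat) : Prop :=
  exists v : 'I_n -> V, ~ lin_dep v.

(* The norm of a [normedModType R[i]] is R[i]-valued, but always lies in the
   nonnegative reals, so the order of R[i] restricts to that of R. *)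
Definition unit_sphere (R : realType) (X : normedModType R[i]) : set X :=
  [set x | `|x| = 1].

Definition unit_ball (R : realType) (X : normedModType R[i]) : set X :=
  [set x | `|x| <= 1].

Arguments unit_sphere {R} X _.
Arguments unit_ball {R} X _.

Definition k_extreme (R : realType) (X : normedModType R[i]) (k : nat)
    (x : X) : Prop :=
  unit_sphere X x /\
  forall y : 'I_k.+1 -> X,
    (forall i, unit_sphere X (y i)) ->
    x = (k.+1%:R : R[i])^-1 *: \sum_(i < k.+1) y i ->
    lin_dep y.

(* Main.v *)
Require Import Defs.
From mathcomp Require Import all_boot all_order all_algebra.
From mathcomp Require Import all_classical reals topology normedtype.
From mathcomp Require Import ring.
Import Order.TTheory GRing.Theory Num.Theory.
Import numFieldNormedType.Exports.
Local Open Scope ring_scope.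
Local Open Scope complex_scope.

(** The points [x + u i] together with [x - \sum_i u i] are [k.+1] points of
    the unit ball whose mean is [x], so the proposition compares linear
    dependence of [k.+1] points with mean [x] and of the first [k] of their
    deviations from [x].  The triangle inequality is an equality at the mean
    [x], which has norm 1, so points of the ball with mean [x] are
    automatically on the sphere ([norm_mean_extremal]).

    A relation between the deviations always gives one between the points: [x]
    is itself a combination of the points ([lin_dep_of_deviations]).  For the
    other implication, a relation [\sum_i c i *: (x + u i) = 0] must be
    cleared of [x], and this is possible because [x] is never a linear
    combination of the deviations ([notin_span_deviations]).  With a norming
    functional [f] at [x], one would say that [|1 + f (u i)| <= 1] and
    [\sum_i f (u i) = 0] force [f (u i) = 0] by strict convexity of the disc,
    whereas [f x = 1].  The proof given here needs no functional.  By convexity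
    the ball contains [x + s *: v] for all small real [s] and all [v] in the
    real span of the deviations; if [x] were in their complex span it would be
    [p + 'i *: q] with [p], [q] such vectors, and the identity in
    [no_flat_complex_decomposition] would make the norm of [x] smaller
    than 1. *)

(** * Norm estimates *)

Section NormEstimates.

Set Implicit Arguments.
Unset Strict Implicit.

Variables (K : numClosedFieldType) (X : normedModType K).
Implicit Types (x p q : X) (s : K).

(** The defects [1 - `|y i|] are nonnegative and, by the triangle inequality,
    have nonpositive sum. *)
Lemma norm_mean_extremal n (y : 'I_n -> X) x :
  `|x| = 1 -> \sum_i y i = n%:R *: x -> (forall i, `|y i| <= 1) ->
  forall i, `|y i| = 1.
Proof.
move=> x1 sumy y1 i.
have defect_ge0 j : true -> 0 <= 1 - `|y j| by rewrite subr_ge0 y1.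
have defect0 : \sum_j (1 - `|y j|) = 0.
  apply/eqP; rewrite eq_le sumr_ge0 // andbT.
  rewrite sumrB sumr_const card_ord subr_le0.
  have -> : 1 *+ n = `|\sum_j y j| :> K.
    by rewrite sumy normrZ x1 mulr1 normr_nat.
  exact: ler_norm_sum.
apply/esym/eqP; rewrite -subr_eq0; apply/eqP.
exact: (psumr_eq0P defect_ge0 defect0).
Qed.

Lemma norm_add_convex_comb n (u : 'I_n -> X) (w : 'I_n -> K) x :
  `|x| <= 1 -> (forall i, `|x + u i| <= 1) ->
  (forall i, 0 <= w i) -> \sum_i w i <= 1 ->
  `|x + \sum_i w i *: u i| <= 1.
Proof.
move=> x1 u1 w0 w1.
have -> : x + \sum_i w i *: u i =
    (1 - \sum_i w i) *: x + \sum_i w i *: (x + u i).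
  under [X in _ = _ + X]eq_bigr do rewrite scalerDr.
  by rewrite big_split /= -scaler_suml scalerBl scale1r addrA subrK.
apply: le_trans (ler_normD _ _) _.
rewrite -[leRHS](subrK (\sum_i w i)) lerD //.
  rewrite normrZ ger0_norm ?subr_ge0 //.
  by rewrite ler_piMr // subr_ge0.
apply: le_trans (ler_norm_sum _ _ _) _.
apply: ler_sum => i _; rewrite normrZ ger0_norm //.
by rewrite ler_piMr.
Qed.

(** Since [\sum_i u i = 0], adding a constant to all the [b i] does not change
    [\sum_i b i *: u i]; adding [B] makes them nonnegative, and then small
    multiples are coefficients of a convex combination. *)
Lemma norm_add_small_real_comb n (u : 'I_n -> X) (b : 'I_n -> K) x (B s : K) :
  `|x| <= 1 -> (forall i, `|x + u i| <= 1) -> \sum_i u i = 0 ->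
  (forall i, b i \is Num.real) -> (forall i, `|b i| <= B) ->
  0 <= s -> s * (n%:R * (B + B)) <= 1 ->
  `|x + s *: \sum_i b i *: u i| <= 1.
Proof.
move=> x1 u1 u0 bR bB s0 sB.
have bBr i : - B <= b i <= B.
  by rewrite -real_ler_norml.
have -> : s *: \sum_i b i *: u i = \sum_i (s * (b i + B)) *: u i.
  under [RHS]eq_bigr do rewrite -scalerA scalerDl.
  by rewrite -scaler_sumr big_split /= -scaler_sumr u0 scaler0 addr0.
apply: norm_add_convex_comb => // [i|].
  by rewrite mulr_ge0 // -lerBlDr sub0r; case/andP: (bBr i).
apply: le_trans sB; rewrite -mulr_sumr ler_wpM2l //.
rewrite mulr_natl -[X in _ *+ X]card_ord -sumr_const ler_sum // => i _.
by rewrite lerD2r; case/andP: (bBr i).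
Qed.

(** Multiplying [x + s *: q] and [x - s *: q] by [1 + 'i * s] and
    [1 - 'i * s], both of modulus [sqrtC (1 + s ^+ 2)], and averaging gives
    [(1 + s ^+ 2) *: x - s ^+ 2 *: p], because ['i *: q = x - p].  Adding
    [x + s ^+ 2 *: p] bounds [2 + s ^+ 2] by [1 + Num.sqrt (1 + s ^+ 2)]. *)
Lemma no_flat_complex_decomposition x p q s :
  `|x| = 1 -> x = p + 'i *: q -> 0 < s ->
  `|x + s *: q| <= 1 -> `|x - s *: q| <= 1 -> `|x + s ^+ 2 *: p| <= 1 ->
  False.
Proof.
move=> x1 xpq s0 qp qm ps.
have sR : s \is Num.real by rewrite gtr0_real.
set m := `|1 + 'i * s|.
have m2 : m ^+ 2 = 1 + s ^+ 2.
  by rewrite normC2_rect ?rpred1 // expr1n.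
have m' : `|1 - 'i * s| = m.
  apply/eqP; rewrite -(@eqrXn2 _ 2) ?normr_ge0 //.
  by rewrite m2 -mulrN normC2_rect ?rpredN ?rpred1 // expr1n sqrrN.
have m_gt1 : 1 < m.
  rewrite -(@ltr_pXn2r _ 2) ?nnegrE ?normr_ge0 ?ler01 //.
  by rewrite m2 expr1n ltrDl exprn_gt0.
have id2 : 2%:R * (1 + m ^+ 2) *: x =
    (1 + 'i * s) *: (x + s *: q) + (1 - 'i * s) *: (x - s *: q)
    + 2%:R *: (x + s ^+ 2 *: p).
  have -> : p = x - 'i *: q by rewrite xpq addrK.
  rewrite m2 !(scalerDr, scalerN, scalerA).
  rewrite [RHS](AC (2*2*(1*2)) ((1*3*5*6)*(2*4*7))) /=.
  rewrite -!(scaleNr _ q) -!scalerDl.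
  rewrite [X in _ + X *: q](_ : _ = 0) ?scale0r ?addr0; last by ring.
  by congr (_ *: x); ring.
have lhs : `|(2%:R * (1 + m ^+ 2)) *: x| = 2%:R * (1 + m ^+ 2).
  by rewrite normrZ x1 mulr1 ger0_norm // mulr_ge0 ?addr_ge0 ?exprn_ge0 ?normr_ge0.
have : 2%:R * (1 + m ^+ 2) <= m + m + 2%:R.
  rewrite -lhs id2; apply: le_trans (ler_normD _ _) _.
  apply: lerD; last by rewrite normrZ normr_nat ler_piMr.
  apply: le_trans (ler_normD _ _) _.
  by apply: lerD; rewrite normrZ ?m' ler_piMr ?normr_ge0.
rewrite (_ : m + m + 2%:R = 2%:R * (m + 1)); last by ring.
rewrite ler_pM2l ?ltr0n // addrC lerD2r expr2 ger_pMl ?(lt_trans ltr01) //.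
by rewrite (lt_geF m_gt1).
Qed.

(** Splitting the coefficients into real and imaginary parts gives
    [x = p + 'i *: q] with [p] and [q] in the real span of the [u i]. *)
Lemma notin_span_deviations n (u : 'I_n -> X) (a : 'I_n -> K) x :
  `|x| = 1 -> (forall i, `|x + u i| <= 1) -> \sum_i u i = 0 ->
  x <> \sum_i a i *: u i.
Proof.
move=> x1 u1 u0 xa.
have a_le i : `|a i| <= \sum_j `|a j|.
  by rewrite (bigD1 i) //= lerDl sumr_ge0.
set B := \sum_j `|a j| in a_le.
have B0 : 0 <= B by rewrite sumr_ge0.
set N := n%:R * (B + B).
have N0 : 0 <= N by rewrite mulr_ge0 // addr_ge0.
have N1 : 0 < 1 + N by rewrite ltr_pwDl.
(* [s <= 1] also makes [s ^+ 2] small enough for the direction [p] *)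
pose s := (1 + N)^-1.
have s0 : 0 < s by rewrite invr_gt0.
have s1 : s <= 1 by rewrite invf_le1 // lerDl.
have sN : s * N <= 1 by rewrite mulrC ler_pdivrMr // mul1r lerDr.
have le_x : `|x| <= 1 by rewrite x1.
have re_le i : `|'Re (a i)| <= B.
  exact: le_trans (leif_normC_Re_Creal _).1 (a_le i).
have im_le i : `|'Im (a i)| <= B.
  apply: le_trans (a_le i); rewrite -normrN -ReMil.
  by rewrite (le_trans (leif_normC_Re_Creal _).1) // normrM normCi mul1r.
apply: (@no_flat_complex_decomposition x (\sum_i 'Re (a i) *: u i)
  (\sum_i 'Im (a i) *: u i) s) => //.
- rewrite [LHS]xa scaler_sumr -big_split; apply: eq_bigr => i _ /=.
  by rewrite scalerA -scalerDl -Crect.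
- exact: (norm_add_small_real_comb (B := B)) (ltW s0) sN.
- rewrite -scalerN -sumrN; under eq_bigr do rewrite -scaleNr.
  by apply: (norm_add_small_real_comb (B := B)) (ltW s0) sN => // i;
    rewrite ?normrN ?rpredN.
- apply: (norm_add_small_real_comb (B := B)) => //; first by rewrite exprn_ge0 // ltW.
  apply: le_trans sN; apply: ler_wpM2r => //.
  by rewrite expr2 ger_pMl.
Qed.

End NormEstimates.

(** * Linear relations *)

Section LinearRelations.

Set Implicit Arguments.
Unset Strict Implicit.

Variables (K : numFieldType) (V : lmodType K).

(** The [k.+1]-st entry makes the sum zero, so that the family treats the [k]
    points [x + u i] and the point [x - \sum_i u i] alike. *)
Definition balance k (u : 'I_k -> V) (i : 'I_k.+1) : V :=
  if unlift ord_max i is Some j then u j else - \sum_j u j.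

Lemma balance_lift k (u : 'I_k -> V) j : balance u (lift ord_max j) = u j.
Proof. by rewrite /balance liftK. Qed.

Lemma balance_max k (u : 'I_k -> V) : balance u ord_max = - \sum_j u j.
Proof. by rewrite /balance unlift_none. Qed.

Lemma sum_balance k (u : 'I_k -> V) : \sum_i balance u i = 0.
Proof.
rewrite (bigD1_ord ord_max) //= balance_max.
by under eq_bigr do rewrite balance_lift; rewrite addNr.
Qed.

(** A relation between the [k.+1] vectors gives one between the first [k] by
    substituting the last one. *)
Lemma lin_dep_of_balance k (u : 'I_k -> V) (c : 'I_k.+1 -> K) :
  (exists i, c i != 0) -> \sum_i c i = 0 ->
  \sum_i c i *: balance u i = 0 -> lin_dep u.
Proof.
move=> [i ci] c0 cu.
exists (fun j => c (lift ord_max j) - c ord_max); split; last first.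
  rewrite (bigD1_ord ord_max) //= balance_max scalerN scaler_sumr in cu.
  rewrite -[RHS]cu addrC -sumrB; apply: eq_bigr => j _.
  by rewrite balance_lift scalerBl.
have [/existsP //|/existsPn const_c] :=
  boolP [exists j, c (lift ord_max j) - c ord_max != 0].
have cE j : c j = c ord_max.
  case: (unliftP ord_max j) => [l ->|-> //].
  by apply/eqP; rewrite -subr_eq0; move: (const_c l); rewrite negbK.
move: c0; under eq_bigr do rewrite cE.
rewrite sumr_const card_ord => /eqP; rewrite mulrn_eq0 /= => /eqP cm.
by move: ci; rewrite cE cm eqxx.
Qed.

(** In a relation [\sum_j d j *: (y j - x) = 0] between the first [k]
    deviations, [x] is replaced by the mean of all the [y i]; the last
    coefficient then vanishes only if [\sum_j d j] does, and the others are
    the [d j] in that case. *)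
Lemma lin_dep_of_deviations k (y : 'I_k.+1 -> V) (x : V) :
  x = (k.+1%:R : K)^-1 *: \sum_i y i ->
  lin_dep (fun j : 'I_k => y (lift ord_max j) - x) -> lin_dep y.
Proof.
move=> xE [d [[j dj] d0]].
pose m := (\sum_j d j) / k.+1%:R.
pose d' (i : 'I_k.+1) := if unlift ord_max i is Some j then d j else 0.
have d'l l : d' (lift ord_max l) = d l by rewrite /d' liftK.
have d'm : d' ord_max = 0 by rewrite /d' unlift_none.
exists (fun i => d' i - m); split; last first.
  under eq_bigr do rewrite scalerBl.
  rewrite sumrB -scaler_sumr /m -scalerA -xE (bigD1_ord ord_max) //= d'm.
  rewrite scale0r add0r scaler_suml -sumrB -[RHS]d0; apply: eq_bigr => l _.
  by rewrite d'l scalerBr.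
have [m0|m0] := eqVneq m 0.
  by exists (lift ord_max j); rewrite d'l m0 subr0.
by exists ord_max; rewrite d'm sub0r oppr_eq0.
Qed.

End LinearRelations.

(** * The characterization of k-extreme points *)

Theorem proposition2p2 (R : realType) (k : nat) (X : normedModType R[i])
    (hX : dim_at_least X k.+1) (x : X) (hx : unit_sphere X x) :
  k_extreme k x <->
  (forall u : 'I_k -> X,
     (forall i : 'I_k, unit_ball X (x + u i)) ->
     unit_ball X (x - \sum_(i < k) u i) ->
     lin_dep u).
Proof.
have k0 : (k.+1%:R : R[i]) != 0 by rewrite pnatr_eq0.
have x1 : `|x| = 1 := hx.
split=> [[_ extx] u u1 last1|depx].
  pose v := balance u.
  have v1 i : `|x + v i| <= 1.
    rewrite /v; case: (unliftP ord_max i) => [j ->|->].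
      by rewrite balance_lift; exact: u1.
    by rewrite balance_max; exact: last1.
  have sumy : \sum_i (x + v i) = k.+1%:R *: x.
    by rewrite big_split /= sum_balance addr0 sumr_const card_ord scaler_nat.
  have [||c [c_neq0 c0]] := extx (fun i => x + v i).
  - exact: norm_mean_extremal x1 sumy v1.
  - by rewrite sumy scalerA mulVf // scale1r.
  have cxv : (\sum_i c i) *: x + \sum_i c i *: v i = 0.
    rewrite -[RHS]c0; under [RHS]eq_bigr do rewrite scalerDr.
    by rewrite big_split /= scaler_suml.
  have [sc0|sc_neq0] := eqVneq (\sum_i c i) 0.
    apply: (lin_dep_of_balance c_neq0 sc0).
    by rewrite -[RHS]cxv sc0 scale0r add0r.
  (* dividing by a nonzero coefficient sum would put x in the span *)
  case: (@notin_span_deviations _ _ _ v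
    (fun i => - (\sum_j c j)^-1 * c i) x x1 v1 (sum_balance _)).
  under eq_bigr do rewrite -scalerA.
  rewrite -scaler_sumr; apply: (scalerI sc_neq0).
  rewrite scalerA mulrN mulfV // scaleN1r.
  by apply/eqP; rewrite -addr_eq0 cxv.
split=> // y y1 xE.
apply: (lin_dep_of_deviations xE); apply: depx => [j|].
  by rewrite /unit_ball /= addrC subrK (y1 _).
suff -> : x - \sum_(j < k) (y (lift ord_max j) - x) = y ord_max.
  by rewrite /unit_ball /= (y1 _).
have : \sum_i y i = k.+1%:R *: x by rewrite xE scalerA mulfV // scale1r.
rewrite (bigD1_ord ord_max) //= sumrB sumr_const card_ord scaler_nat mulrS.
by move=> ysum; rewrite opprB addrA -ysum addrK.
Qed.
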